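(* Let $k \ge 3$ and $n \ge k-1$ be integers, and let $H$ be a linear triple system on $n$ vertices with linear density $c$. If $$|E(H)| > \frac{k-2}{9(k-1)}\,n^2 + \frac{n}{3},$$ then $H$ contains a $(k+3,\,k)$-configuration. This hypothesis is equivalent to $$c > \frac{2(k-2)}{3(k-1)} \cdot \frac{n}{n-1} + \frac{2}{n-1},$$ so the latter is also sufficient. Thus there is an absolute constant $C$ such that for all integers $k \ge 3$ and $n \ge k-1$, every linear triple system on $n$ vertices with linear density $c \ge \frac{2(k-2)}{3(k-1)} + \frac{C}{n}$ contains a $(k+3,\,k)$-configuration; in particular, for $k=4$, linear density $c \ge \frac{4}{9} + \frac{C}{n}$ suffices for a $(7,4)$-configuration.
   Context: A triple system is a $3$-uniform hypergraph: a finite vertex set $V(H)$ together with a set $E(H)$ of (distinct) $3$-element subsets of $V(H)$, called edges. It is linear if any two distinct edges intersect in at most one vertex. The linear density of a linear triple system $H$ on $n$ vertices is the number $c$ defined by $|E(H)| = c\,\binom{n}{2}/\binom{3}{2}$. For integers $s > k \ge 2$, an $(s,k)$-configuration in $H$ is a collection of $k$ distinct edges of $H$ whose union has at most $s$ vertices. *)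

(* Defs.v *)
From mathcomp Require Import all_boot all_order all_algebra.

Set Implicit Arguments.
Unset Strict Implicit.
Unset Printing Implicit Defensive.

Import Order.TTheory GRing.Theory Num.Theory.

Local Open Scope ring_scope.

(* The vertex set of a triple system is the whole finite type V. *)
Record triple_system (V : finType) := TripleSystem {
  edges : {set {set V}};
  card_edge : forall e, e \in edges -> #|e| = 3
}.

Definition linear_system (V : finType) (H : triple_system V) : Prop :=
  forall e f, e \in edges H -> f \in edges H -> e != f -> (#|e :&: f| <= 1)%N.

(* This equation determines c as soon as V has at least two vertices. *)
Definition has_linear_density (R : realFieldType) (V : finType)
    (H : triple_system V) (c : R) : Prop :=
  #|edges H|%:R = c * 'C(#|V|, 2)%:R / 'C(3, 2)%:R.

Definition is_configuration (V : finType) (H : triple_system V) (s k : nat)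
    (F : {set {set V}}) : Prop :=
  [/\ F \subset edges H, #|F| = k & (#|cover F| <= s)%N].

Definition contains_configuration (V : finType) (H : triple_system V)
    (s k : nat) : Prop :=
  exists F : {set {set V}}, is_configuration H s k F.

(* Main.v *)
Require Import Defs.
From mathcomp Require Import all_boot all_order all_algebra.
From mathcomp Require Import zify ring lra.

Set Implicit Arguments.
Unset Strict Implicit.
Unset Printing Implicit Defensive.

Import Order.TTheory GRing.Theory Num.Theory.

Local Open Scope nat_scope.

(** Let e be an edge of a linear triple system H. Every other edge f meeting e
    does so in one vertex, so the pairs f :\: e form a graph, the union of the
    links of the three vertices of e. If s edges of this graph cover at most
    s + 1 vertices, then the s triples they come from, together with e itself,
    are s + 1 triples on at most (s + 1) + 3 vertices. With s = k - 1 this is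
    the configuration wanted, so the theorem follows from two estimates.

    Some edge has a dense link graph. The sum over the edges e of the degree
    sum of e is the sum of the squared degrees, hence at least (3m)^2 / n by
    Cauchy-Schwarz, where m is the number of edges. So some e has degree sum at
    least 9m / n ([exists_dense_edge]), and its link graph has 3 edges fewer
    than that, since e is counted at each of its vertices. The bound assumed on
    m makes this number larger than (s - 1) n / s.

    A locally sparse graph is globally sparse ([locally_sparse_card]). If no s
    edges of a graph cover at most s + 1 vertices, and the graph has at least s
    edges, then it has at most (s - 1) / s times as many edges as vertices.
    Indeed, components that are trees have at most s - 1 edges, and the ratio
    of edges to vertices is at most (s - 1) / s for them. A component with a
    cycle may have a larger ratio, but it covers at most as many vertices as it
    has edges, so one may add to it edges from other components; that the
    result never reaches s edges forces the whole graph to be sparse. The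
    induction keeps track of this with a budget b of extra vertices, which trees
    decrease and components with cycles do not.

    The conditions on m and on the linear density c are the same inequality up
    to multiplication by n (n - 1) / 6, and replacing n / (n - 1) by 1 costs an
    error of order 1 / n. *)

(** * Locally sparse graphs *)

Section Graph.
Variable T : finType.
Implicit Types (E F : {set {set T}}) (e : {set T}).

Lemma coverU E F : cover (E :|: F) = cover E :|: cover F.
Proof. exact: bigcup_setU. Qed.

Lemma cover1 e : cover [set e] = e.
Proof. by rewrite /cover big_set1. Qed.

(** For F a subset of the edge set E, this says that F is a union of connected
    components of E. *)
Definition isolated F E :=
  [disjoint cover F & cover (E :\: F)].

Lemma isolatedC E F : F \subset E -> isolated F E -> isolated (E :\: F) E.
Proof.
by move=> sFE; rewrite /isolated setDDr setDv set0U (setIidPr sFE) disjoint_sym.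
Qed.

Lemma isolated_card_cover E F : F \subset E -> isolated F E ->
  #|cover E| = #|cover F| + #|cover (E :\: F)|.
Proof.
move=> sFE; rewrite /isolated -(leq_card_setU _ _).2 -coverU => /eqP <-.
by rewrite -{1}(setID E F) (setIidPr sFE).
Qed.

(** An edge meeting the vertices covered by F adds at most one vertex to them.
    So a largest F among the sets of at most s edges that cover at most
    one vertex more than they have edges cannot be extended: it is isolated. *)
Lemma exists_isolated E s :
  {in E, forall e, #|e| = 2} -> 0 < #|E| -> 0 < s ->
  (forall F, F \subset E -> #|F| = s -> s.+1 < #|cover F|) ->
  exists F, [/\ F \subset E, 0 < #|F| < s, #|cover F| <= #|F|.+1
             & isolated F E].
Proof.
move=> E2 E0 s0 sparse.
have [e eE] : exists e, e \in E by apply/set0Pn; rewrite -card_gt0.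
pose P F := [&& F \subset E, 0 < #|F| <= s & #|cover F| <= #|F|.+1].
have P1 : P [set e] by rewrite /P sub1set eE cards1 cover1 (E2 e eE) s0.
case: (arg_maxnP (fun F : {set {set T}} => #|F|) P1) => F /and3P[sFE /andP[F0 Fs] cF] Fmax.
have {}Fs : #|F| < s.
  rewrite ltn_neqAle Fs andbT; apply/eqP=> FS.
  by have := sparse F sFE FS; rewrite ltnNge -FS cF.
exists F; split=> //; first by rewrite F0.
rewrite /isolated disjoint_sym /cover.
apply/pred0P=> x /=; apply/negbTE/andP=> -[/bigcupP[f /setDP[fE fF] xf] xF].
suff /Fmax : P (f |: F) by rewrite /= cardsU1 fF add1n ltnn.
rewrite /P subUset sub1set fE sFE cardsU1 fF add1n Fs /= coverU cover1.
rewrite cardsU (E2 f fE).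
have : 0 < #|f :&: cover F| by rewrite card_gt0; apply/set0Pn; exists x; rewrite inE xf.
by move: cF; rewrite /=; lia.
Qed.

(** The conclusion is |E| <= (s - 1) (|V| - |E| - b + 1), where V is the set of
    covered vertices, with the subtractions moved to the other side.
    If b = 1 it says that |E| <= (s - 1) / s |V|; larger budgets are needed for
    the induction, in which an isolated set F is removed. Removing F replaces
    s by s - |F| and b by b + |F| - |cover F|, because a set violating the
    hypothesis in the rest could be completed by F. The factor on the right of
    the conclusion is unchanged by this, except for s. *)
Lemma locally_sparse_card E s b :
  {in E, forall e, #|e| = 2} -> 0 < b -> s <= #|E| ->
  (forall F, F \subset E -> #|F| = s -> s + b < #|cover F|) ->
  #|E| + s.-1 * (#|E| + b.-1) <= s.-1 * #|cover E|.
Proof.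
have [m] := ubnP #|E|; elim: m => // m IH in E s b *.
move=> /ltnSE Em E2 b0 sE sparse.
have s0 : 0 < s.
  case: s sE sparse => // _ /(_ set0 (sub0set _) (cards0 _)).
  by rewrite /cover big_set0 cards0.
(* The removal of F described above, valid while the new budget is positive. *)
have peel F : F \subset E -> 0 < #|F| < s -> isolated F E ->
    #|cover F| < #|F| + b ->
    #|E| + s.-1 * (#|E| + b.-1) <= s.-1 * #|cover E|.
  move=> sFE /andP[F0 Fs] iF cF.
  have cE := isolated_card_cover sFE iF.
  have nE : #|E| = #|F| + #|E :\: F| by rewrite -(cardsID F E) (setIidPr sFE).
  have := IH (E :\: F) (s - #|F|) (#|F| + b - #|cover F|).
  have -> : #|E :\: F| < m by lia.
  have -> : 0 < #|F| + b - #|cover F| by lia.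
  have -> : s - #|F| <= #|E :\: F| by lia.
  move/(_ isT) => H.
  have {}H := H (fun e He => E2 e (subsetP (subsetDl E F) e He)) isT isT.
  have {H} : #|E :\: F| + (s - #|F|).-1 * (#|E :\: F| + (#|F| + b - #|cover F|).-1)
     <= (s - #|F|).-1 * #|cover (E :\: F)|.
    apply: H => A sA nA.
    have dA : [disjoint F & A].
      by apply: disjointWr sA _; rewrite disjoint_sym -setI_eq0 setIDAC setDIl setDv setI0.
    have := sparse (F :|: A).
    rewrite subUset sFE (subset_trans sA (subsetDl _ _)).
    have := cardsUI F A; rewrite (disjoint_setI0 dA) cards0 coverU.
    have := (leq_card_setU (cover F) (cover A)).1.
    move=> h1 h2 h3; have {}h3 := h3 isT ltac:(lia). lia.
  have E'0 : 0 < #|E :\: F| by lia.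
  (* The factor V' - (E' + B) that multiplies s - 1 must be shown positive: then
     the |F| edges removed are paid for by the decrease of s. *)
  have -> : s.-1 = (s - #|F|).-1 + #|F| by lia.
  have : #|cover F| + (#|F| + b - #|cover F|).-1 = #|F| + b.-1 by lia.
  rewrite cE nE.
  move: (#|E :\: F|) (#|cover (E :\: F)|) (#|F|) (#|cover F|) E'0 ((s - _).-1) (_.-1) (b.-1).
  move=> E' V' f v E'0 t B b1 eqB H.
  have ltV : E' + B < V'.
    rewrite ltnNge; apply/negP=> leV; have := leq_mul (leqnn t) leV; lia.
  have -> : f + E' + b1 = v + (E' + B) by lia.
  have := leq_mul (leqnn f) ltV; rewrite !mulnDr !mulnDl; lia.
have sparse1 F : F \subset E -> #|F| = s -> s.+1 < #|cover F|.
  by move=> sF nF; have := sparse F sF nF; lia.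
have [F [sFE /andP[F0 Fs] cF iF]] := exists_isolated E2 (leq_trans s0 sE) s0 sparse1.
have [cFb|cFb] := ltnP #|cover F| (#|F| + b).
  by apply: peel cFb; rewrite ?F0.
(* The budget is 1 and F behaves like a tree, so peeling F off would leave no
   budget. Instead, the bound is proved for F and for the rest separately, with
   s and b unchanged, and added up. *)
have b1 : b = 1 by lia.
have nE : #|E| = #|F| + #|E :\: F| by rewrite -(cardsID F E) (setIidPr sFE).
have cE := isolated_card_cover sFE iF.
have [lE|lE] := leqP s #|E :\: F|.
  have : #|E :\: F| + s.-1 * (#|E :\: F| + b.-1) <= s.-1 * #|cover (E :\: F)|.
    apply: IH => //; first lia.
      by move=> e /(subsetP (subsetDl E F)); apply: E2.
    by move=> A sA; apply: sparse; apply: subset_trans sA (subsetDl _ _).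
  rewrite nE cE; nia.
(* If the rest is too small for the induction hypothesis and has excess edges,
   it must be peeled off first, in place of F. *)
have [cE'|cE'] := leqP #|cover (E :\: F)| #|E :\: F|.
  apply: (peel (E :\: F)); rewrite ?subsetDl //; [lia | exact: isolatedC | lia].
rewrite nE cE; nia.
Qed.

End Graph.

(** * The link graph of an edge *)

Section Triples.
Variables (V : finType) (H : triple_system V).
Hypothesis Hlin : linear_system H.

Definition neighbours (e : {set V}) : {set {set V}} := [set f in edges H | (f != e) && ~~ [disjoint f & e]].
Definition link (e : {set V}) : {set {set V}} := [set f :\: e | f in neighbours e].

Lemma neighbour_meet e f : e \in edges H -> f \in neighbours e -> #|f :&: e| = 1.
Proof.
rewrite inE => eH /and3P[fH fe]; rewrite -setI_eq0 -card_gt0 => me.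
by apply/eqP; rewrite eqn_leq me Hlin.
Qed.

Lemma card_link_edge e : e \in edges H -> {in link e, forall p : {set V}, #|p| = 2}.
Proof.
move=> eH _ /imsetP[f fN ->]; rewrite cardsD (neighbour_meet eH fN).
by move: fN; rewrite inE => /andP[/card_edge -> _].
Qed.

Lemma link_inj e : e \in edges H -> {in neighbours e &, injective (fun f => f :\: e)}.
Proof.
move=> eH f g fN gN /= fg; apply/eqP/negPn/negP=> ne.
have fH : f \in edges H by move: fN; rewrite inE => /andP[].
have gH : g \in edges H by move: gN; rewrite inE => /andP[].
have := Hlin fH gH ne; rewrite leqNgt => /negP; apply.
rewrite -(card_link_edge eH (imset_f _ fN)); apply: subset_leq_card.
by rewrite subsetI subsetDl fg subsetDl.
Qed.

(** The configuration is e with the s triples giving the edges of F: all their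
    vertices lie in e or in cover F. *)
Lemma link_configuration e s (F : {set {set V}}) :
  e \in edges H -> F \subset link e -> #|F| = s -> #|cover F| <= s.+1 ->
  contains_configuration H (s + 4) s.+1.
Proof.
move=> eH sF nF cF.
pose A := [set f in neighbours e | f :\: e \in F].
have sA : A \subset neighbours e by apply/subsetP=> f; rewrite inE => /andP[].
have FA : F = [set f :\: e | f in A].
  apply/setP=> p; apply/idP/imsetP => [pF|[f + ->]]; last by rewrite inE => /andP[].
  have /imsetP[f fN pf] := subsetP sF p pF.
  by exists f; rewrite // inE fN -pf.
have nA : #|A| = s.
  by rewrite -nF FA card_in_imset // => f g /(subsetP sA) fN /(subsetP sA); apply: link_inj.
exists (e |: A); split.
- rewrite subUset sub1set eH; apply: subset_trans sA _.
  by apply/subsetP=> f; rewrite inE => /andP[].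
- by rewrite cardsU1 nA; case: (boolP (e \in A)) => //; rewrite !inE eqxx andbF.
have sub : cover (e |: A) \subset e :|: cover F.
  apply/subsetP=> x /bigcupP[f]; rewrite !inE => /orP[/eqP -> -> //|/andP[_ fF] xf].
  case: (boolP (x \in e)) => //= xe; apply/bigcupP; exists (f :\: e) => //.
  by rewrite inE xe.
apply: leq_trans (subset_leq_card sub) _.
have := (leq_card_setU e (cover F)).1; rewrite (card_edge eH); lia.
Qed.

(** The density required is the ratio (s - 1) / s of [locally_sparse_card], with
    all of V in place of the vertices that the link graph covers. *)
Lemma neighbours_configuration e s :
  e \in edges H -> s <= #|neighbours e| ->
  s.-1 * #|V| < s * #|neighbours e| ->
  contains_configuration H (s + 4) s.+1.
Proof.
move=> eH sN dense.
have nL : #|link e| = #|neighbours e| by rewrite card_in_imset //; apply: link_inj.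
have [/existsP[F /and3P[sF /eqP nF cF]]|/existsPn none] :=
  boolP [exists F : {set {set V}}, [&& F \subset link e, #|F| == s & #|cover F| <= s.+1]].
  exact: link_configuration eH sF nF cF.
have := @locally_sparse_card _ (link e) s 1 (card_link_edge eH) isT.
rewrite nL => /(_ sN) h; have {}h : #|neighbours e| + s.-1 * (#|neighbours e| + 1.-1) <= s.-1 * #|cover (link e)|.
  apply: h => F sF nF; rewrite addn1 ltnNge; apply/negP=> cF.
  by have := none F; rewrite sF nF eqxx cF.
have cV : #|cover (link e)| <= #|V| by apply: max_card.
have := leq_mul (leqnn s.-1) cV; move: dense h; case: (s) => [|t] /=; lia.
Qed.

(** * An edge with a dense link graph *)

Definition degree x := #|[set f in edges H | x \in f]|.

Lemma sum_card_setI_degree (A : {set {set V}}) (B : {set V}) : 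
  \sum_(f in A) #|f :&: B| = \sum_(x in B) #|[set f in A | x \in f]|.
Proof.
transitivity (\sum_(f in A) \sum_(x in B) (x \in f : nat)).
  apply: eq_bigr => f _; rewrite -sum1_card big_mkcond [RHS]big_mkcond.
  by apply: eq_bigr => x _; rewrite inE andbC; do 2 case: (_ \in _).
rewrite exchange_big; apply: eq_bigr => x _.
rewrite -sum1_card big_mkcond [RHS]big_mkcond.
by apply: eq_bigr => f _; rewrite inE; do 2 case: (_ \in _).
Qed.

Lemma sum_degree : \sum_x degree x = 3 * #|edges H|.
Proof.
have := sum_card_setI_degree (edges H) setT.
rewrite (eq_bigr (fun=> 3)) => [|f fH]; last by rewrite setIT (card_edge fH).
by rewrite sum_nat_const mulnC => ->; apply: eq_bigl => x; rewrite inE.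
Qed.

(** By linearity, the degree sum of e counts each neighbour once; it counts e
    itself three times. *)
Lemma sum_degree_edge e : e \in edges H ->
  \sum_(x in e) degree x = #|neighbours e| + 3.
Proof.
move=> eH; rewrite -sum_card_setI_degree (bigD1 e) //= setIid (card_edge eH) addnC.
congr (_ + _); rewrite -sum1_card [LHS]big_mkcond [RHS]big_mkcond.
apply: eq_bigr => f _; have := @neighbour_meet e f eH; rewrite inE.
case: (f \in edges H) => //=; case: (f != e) => //=; rewrite -setI_eq0.
by case: eqP => [-> _|_ ->] //; rewrite cards0.
Qed.

Lemma sum_degree_sqr :
  \sum_x degree x ^ 2 = \sum_(e in edges H) (#|neighbours e| + 3).
Proof.
transitivity (\sum_(e in edges H) \sum_(x in e) degree x); last first.
  by apply: eq_bigr => e eH; rewrite sum_degree_edge.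
rewrite (exchange_big_dep predT) //=; apply: eq_bigr => x _.
rewrite sum_nat_const -mulnn; congr (_ * _).
by apply: eq_card => f; rewrite !inE.
Qed.

End Triples.

(** The Cauchy-Schwarz inequality against the constant 1, obtained by summing
    2 f(i) f(j) <= f(i)^2 + f(j)^2 over all pairs. *)
Lemma sqr_sum_leq (I : finType) (f : I -> nat) :
  (\sum_i f i) ^ 2 <= #|I| * \sum_i f i ^ 2.
Proof.
rewrite -(@leq_pmul2l 2) //.
have -> : (\sum_i f i) ^ 2 = \sum_i \sum_j f i * f j.
  by rewrite -mulnn big_distrl; apply: eq_bigr => i _; rewrite big_distrr.
have -> : 2 * (#|I| * \sum_i f i ^ 2) = \sum_i \sum_j (f i ^ 2 + f j ^ 2).
  rewrite mul2n -addnn; under [RHS]eq_bigr do rewrite big_split /= sum_nat_const.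
  by rewrite big_split /= sum_nat_const big_distrr.
rewrite big_distrr; apply: leq_sum => i _ /=; rewrite big_distrr; apply: leq_sum => j _ /=.
by rewrite nat_Cauchy.
Qed.

(** An averaging argument: the degree sums of the m edges add up to the sum of
    the squared degrees, and the degrees of the n vertices add up to 3m, so the
    mean degree sum of an edge is at least (3m)^2 / (n m) = 9m / n. *)
Lemma exists_dense_edge (V : finType) (H : triple_system V) : linear_system H ->
  0 < #|edges H| ->
  exists2 e, e \in edges H & 9 * #|edges H| <= #|V| * (#|neighbours H e| + 3).
Proof.
move=> Hlin H0.
have [/existsP[e /andP[eH he]]|/existsPn none] :=
  boolP [exists e, (e \in edges H) && (9 * #|edges H| <= #|V| * (#|neighbours H e| + 3))].
  by exists e.
have := sqr_sum_leq (degree H); rewrite sum_degree (sum_degree_sqr Hlin).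
suff : #|V| * \sum_(e in edges H) (#|neighbours H e| + 3) < #|edges H| * (9 * #|edges H|) by nia.
have [e0 e0H] : exists e, e \in edges H by apply/set0Pn; rewrite -card_gt0.
rewrite big_distrr -sum_nat_const (bigD1 e0) //= [ltnRHS](bigD1 e0) //= -addSn.
apply: leq_add.
  by have := none e0; rewrite e0H /= -ltnNge.
apply: leq_sum => e /andP[eH _]; apply: ltnW.
by have := none e; rewrite eH /= -ltnNge.
Qed.

(** The hypothesis is m > (s - 1) / (9 s) n^2 + n / 3 with denominators
    cleared. *)
Lemma many_edges_configuration (V : finType) (H : triple_system V) s :
  linear_system H -> 0 < s <= #|V| ->
  s.-1 * #|V| ^ 2 + 3 * s * #|V| < 9 * s * #|edges H| ->
  contains_configuration H (s + 4) s.+1.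
Proof.
move=> Hlin /andP[s0 sV] dense.
have H0 : 0 < #|edges H| by nia.
have [e eH he] := exists_dense_edge Hlin H0.
have dN : s.-1 * #|V| < s * #|neighbours H e|.
  rewrite -(@ltn_pmul2l #|V|); first nia.
  by lia.
apply: (@neighbours_configuration _ _ Hlin e s) => //; nia.
Qed.

(** * Edge counts and linear density *)

Local Open Scope ring_scope.

Lemma many_edgesE (R : realFieldType) (k n m : nat) :
  (3 <= k)%N ->
  (m%:R > (k%:R - 2) / (9 * (k%:R - 1)) * n%:R ^+ 2 + n%:R / 3 :> R) =
  (k.-1.-1 * n ^ 2 + 3 * k.-1 * n < 9 * k.-1 * m)%N.
Proof.
case: k => [|[|k]] // k1; rewrite !succnK -(ltr_nat R) natrD !natrM.
have -> : k.+2%:R - 2 = k%:R :> R by rewrite -addn2 natrD addrK.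
have -> : k.+2%:R - 1 = k.+1%:R :> R by rewrite -addn1 natrD addrK.
have k0 : k.+1%:R != 0 :> R by rewrite pnatr_eq0.
have p : 0 < 9 * k.+1%:R :> R by rewrite mulr_gt0 ?ltr0n.
rewrite -[LHS](ltr_pM2l p); congr (_ < _).
by field; rewrite nat1r.
Qed.

(** Since c n (n - 1) / 6 is the number of edges, the two sides differ by a
    positive factor. *)
Lemma many_edges_density (R : realFieldType) (k : nat) (V : finType)
    (H : triple_system V) (c : R) :
  (3 <= k)%N -> (2 <= #|V|)%N -> has_linear_density H c ->
  ((k%:R - 2) / (9 * (k%:R - 1)) * #|V|%:R ^+ 2 + #|V|%:R / 3 < #|edges H|%:R :> R)
  = (2 * (k%:R - 2) / (3 * (k%:R - 1)) * (#|V|%:R / (#|V|%:R - 1))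
     + 2 / (#|V|%:R - 1) < c).
Proof.
move=> k3; rewrite -(ler_nat R) => n2 ->; move: (#|V|) n2 => n n2.
have k3R : 3 <= k%:R :> R by rewrite ler_nat.
have p : 0 < n%:R * (n%:R - 1) / 6 :> R.
  by rewrite divr_gt0 ?mulr_gt0 //; lra.
have n1 : n%:R - 1 = n.-1%:R :> R.
  by rewrite -subn1 natrB // -(ler_nat R); lra.
have -> : 'C(n, 2)%:R = n%:R * (n%:R - 1) / 2 :> R.
  have := mul_bin_diag n 1; rewrite bin1 => bin2R.
  by rewrite n1 -natrM bin2R natrM mulrAC divff ?mul1r // pnatr_eq0.
rewrite -[RHS](ltr_pM2l p); congr (_ < _).
  by field; apply/andP; split; apply: lt0r_neq0; lra.
by rewrite (_ : 'C(3, 2) = 3%N) //; field.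
Qed.

(** The left-hand side is a + (a + 2) / (x - 1); the constant 16 / 3 is
    2 (2 / 3 + 2), as x - 1 >= x / 2. *)
Lemma density_error_term (R : realFieldType) (a x : R) :
  2 <= x -> a < 2 / 3 ->
  a * (x / (x - 1)) + 2 / (x - 1) < a + 16 / 3 / x.
Proof.
move=> x2 a23.
have -> : a * (x / (x - 1)) + 2 / (x - 1) = a + (a + 2) / (x - 1).
  by field; apply: lt0r_neq0; lra.
rewrite ltrD2l ltr_pdivrMr; last by lra.
rewrite mulrAC ltr_pdivlMr; last by lra.
nra.
Qed.

Theorem corollary1p3 (R : realFieldType) :
  (forall (k n : nat) (V : finType) (H : triple_system V) (c : R),
     (3 <= k)%N -> (k - 1 <= n)%N -> #|V| = n ->
     linear_system H -> has_linear_density H c ->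
     let many_edges :=
       #|edges H|%:R > (k%:R - 2) / (9 * (k%:R - 1)) * n%:R ^+ 2 + n%:R / 3 :> R in
     let large_density :=
       c > 2 * (k%:R - 2) / (3 * (k%:R - 1)) * (n%:R / (n%:R - 1))
           + 2 / (n%:R - 1) in
     [/\ many_edges -> contains_configuration H (k + 3) k,
         many_edges <-> large_density
       & large_density -> contains_configuration H (k + 3) k])
  /\
  (exists C : R,
     (forall (k n : nat) (V : finType) (H : triple_system V) (c : R),
        (3 <= k)%N -> (k - 1 <= n)%N -> #|V| = n ->
        linear_system H -> has_linear_density H c ->
        c >= 2 * (k%:R - 2) / (3 * (k%:R - 1)) + C / n%:R ->
        contains_configuration H (k + 3) k)
     /\
     (forall (n : nat) (V : finType) (H : triple_system V) (c : R),
        (3 <= n)%N -> #|V| = n ->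
        linear_system H -> has_linear_density H c ->
        c >= 4 / 9 + C / n%:R ->
        contains_configuration H 7 4)).
Proof.
have config (k : nat) (V : finType) (H : triple_system V) :
    (3 <= k)%N -> (k - 1 <= #|V|)%N -> linear_system H ->
    (k%:R - 2) / (9 * (k%:R - 1)) * #|V|%:R ^+ 2 + #|V|%:R / 3
      < #|edges H|%:R :> R ->
    contains_configuration H (k + 3) k.
  move=> k3 kn Hlin; rewrite many_edgesE // => dense.
  have -> : (k + 3 = k.-1 + 4)%N by lia.
  rewrite {2}(_ : k = k.-1.+1); last by lia.
  by apply: many_edges_configuration => //; lia.
split=> [k n V H c k3 kn nV Hlin dens many large|].
  have equiv : many = large :> bool.
    by rewrite /many -nV (many_edges_density _ _ dens) ?nV //; lia.
  have conf : many -> contains_configuration H (k + 3) k.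
    by rewrite /many -nV; apply: config; rewrite ?nV.
  by split=> //; rewrite -?[large]equiv.
have configC (k n : nat) (V : finType) (H : triple_system V) (c : R) :
    (3 <= k)%N -> (k - 1 <= n)%N -> #|V| = n ->
    linear_system H -> has_linear_density H c ->
    c >= 2 * (k%:R - 2) / (3 * (k%:R - 1)) + 16 / 3 / n%:R ->
    contains_configuration H (k + 3) k.
  move=> k3 kn nV Hlin dens hc; apply: config; rewrite ?nV //.
  rewrite -nV (many_edges_density _ _ dens) ?nV //; last by lia.
  apply: lt_le_trans hc; apply: density_error_term; first by rewrite ler_nat; lia.
  have k3R : 3 <= k%:R :> R by rewrite ler_nat.
  by rewrite ltr_pdivrMr; lra.
exists (16 / 3); split=> // n V H c n3 nV Hlin dens hc.
apply: (configC 4%N n V H c _ n3 nV Hlin dens) => //.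
by apply: le_trans hc; rewrite lerD2r ler_pdivrMr; lra.
Qed.
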